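(* Let $\varphi$ be an $\mathrm{FO}^2$ formula (with at most one free variable $x$) over a finite set $\mathcal{P}$ of unary predicates, with quantifier depth $k$, and let $\Sigma=2^{\mathcal{P}}$. Then there is a deterministic parity automaton over $\Sigma$ having $2^{2^{O(k^2|\mathcal{P}|)}}$ states and $2^{O(k|\mathcal{P}|)}$ priorities that accepts the language $L(\varphi)=\{w\in\Sigma^\omega:(w,0)\models\varphi\}$.
   Context: An $\omega$-word $u=u_0u_1\ldots$ over $\Sigma=2^{\mathcal{P}}$ is a first-order structure with domain $\mathbb{N}$, predicate $P\in\mathcal{P}$ interpreted as $\{n:P\in u_n\}$, $<$ the usual order, and $\mathrm{suc}(x,y)$ holding iff $y=x+1$. $\mathrm{FO}^2$ consists of first-order formulas over unary predicates, $<$, $\mathrm{suc}$ and equality using only the two variables $x,y$. A deterministic parity automaton has a total deterministic transition function and a priority function from states to $\mathbb{N}$; it accepts an $\omega$-word iff the highest priority occurring infinitely often along its run is even. *)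

(* Defs.v *)
From mathcomp Require Import all_boot.

Set Implicit Arguments.
Unset Strict Implicit.
Unset Printing Implicit Defensive.

Definition word (S : Type) := nat -> S.

Inductive var : Type := VX | VY.

Definition eq_var (u v : var) : bool :=
  match u, v with
  | VX, VX | VY, VY => true
  | _, _ => false
  end.

Inductive fo2 (P : Type) : Type :=
  | Pred of P & var
  | Lt of var & var
  | Suc of var & var
  | Eq of var & var
  | Not of fo2 P
  | And of fo2 P & fo2 P
  | Or of fo2 P & fo2 P
  | Ex of var & fo2 P
  | All of var & fo2 P.

Fixpoint free (P : Type) (v : var) (phi : fo2 P) : bool :=
  match phi with
  | Pred _ u => eq_var u v
  | Lt u1 u2 | Suc u1 u2 | Eq u1 u2 => eq_var u1 v || eq_var u2 v
  | Not a => free v a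
  | And a b | Or a b => free v a || free v b
  | Ex u a | All u a => ~~ eq_var u v && free v a
  end.

Fixpoint qdepth (P : Type) (phi : fo2 P) : nat :=
  match phi with
  | Pred _ _ | Lt _ _ | Suc _ _ | Eq _ _ => 0
  | Not a => qdepth a
  | And a b | Or a b => maxn (qdepth a) (qdepth b)
  | Ex _ a | All _ a => (qdepth a).+1
  end.

Definition update (e : var -> nat) (v : var) (n : nat) : var -> nat :=
  fun u => if eq_var u v then n else e u.

Fixpoint sat (P : finType) (w : word {set P}) (e : var -> nat) (phi : fo2 P) :
    Prop :=
  match phi with
  | Pred p v => p \in w (e v)
  | Lt u v => e u < e v
  | Suc u v => e v = (e u).+1 (* suc(x,y) means y = x + 1 *)
  | Eq u v => e u = e v
  | Not a => ~ sat w e a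
  | And a b => sat w e a /\ sat w e b
  | Or a b => sat w e a \/ sat w e b
  | Ex v a => exists n : nat, sat w (update e v n) a
  | All v a => forall n : nat, sat w (update e v n) a
  end.

(* (w, 0) |= phi for phi with no free variable other than VX; the value 0
   also given to VY is then irrelevant. *)
Definition fo2_language (P : finType) (phi : fo2 P) (w : word {set P}) : Prop :=
  sat w (fun=> 0) phi.

Record dpa (S : Type) := DPA {
  state : finType;
  init : state;
  delta : state -> S -> state;
  prio : state -> nat
}.

Fixpoint run (S : Type) (A : dpa S) (w : word S) (n : nat) : state A :=
  if n is m.+1 then delta (run A w m) (w m) else init A.

Definition inf_often (Q : nat -> Prop) : Prop :=
  forall n, exists2 m, n <= m & Q m.

Definition accepts (S : Type) (A : dpa S) (w : word S) : Prop :=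
  exists p : nat,
    [/\ ~~ odd p,
        inf_often (fun n => prio (run A w n) = p)
      & forall q, inf_often (fun n => prio (run A w n) = q) -> q <= p].

Definition num_states (S : Type) (A : dpa S) : nat := #|state A|.

Definition num_priorities (S : Type) (A : dpa S) : nat :=
  size (undup (codom (@prio S A))).

(* Main.v *)
Require Import Defs.
From mathcomp Require Import all_boot boolp zify.

(* Depth-k FO2 equivalence of pointed words is a one-pebble back-and-forth game
   with the moves "far left, predecessor, stay, successor, far right".  Two
   facts about this game give the automaton.

   In a finite word u, some s marks, with s + 1 <= (2W + 3)^k and W the number
   of windows of radius k, are such that two positions with the same window and
   the same place relative to the marks have the same depth-k type in u v, for
   every continuation v.  The marks of depth r + 1 are the marks of depth r,
   their neighbours, and the neighbours of the first and last position of each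
   class of depth r.  Cutting out the factor between two positions of the same
   type preserves the types of the remaining positions, so every u is
   equivalent, for all continuations, to a word of length at most W (2W + 3)^k:
   these short words are states tracking the prefix.

   If F is the set of factors of length 2k + 1 recurring in w, then the truth of
   the formula is determined by any long enough prefix of w together with F.
   The automaton therefore guesses F as the set T of factors seen since the
   last occurrence of the current one.  Eventually T is included in F, and T = F
   infinitely often, so with priority 2 |T|, plus 1 when the prefix followed by
   a T-recurrent continuation falsifies the formula, the limit superior is
   decided by the correct guess. *)

Set Implicit Arguments.
Unset Strict Implicit.
Unset Printing Implicit Defensive.

(** * Back-and-forth equivalence *)

(** This fixes all atoms [<], [suc] and [=] between two positions; equality is the failure of both
    strict inequalities. *)
Definition same_dir (i i2 j j2 : nat) : Prop :=
  [/\ (i < i2) = (j < j2), (i2 < i) = (j2 < j),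
      (i2 == i.+1) = (j2 == j.+1) & (i == i2.+1) = (j == j2.+1)].

(** One pebble suffices: quantifying over one of two variables forgets its value and keeps only the
    other position. *)
Fixpoint bisim (S : Type) (r : nat) (w : word S) (i : nat) (w' : word S)
    (j : nat) : Prop :=
  w i = w' j /\
  if r is r'.+1 then
    (forall i2, exists2 j2, same_dir i i2 j j2 & bisim r' w i2 w' j2) /\
    (forall j2, exists2 i2, same_dir i i2 j j2 & bisim r' w i2 w' j2)
  else True.

Lemma same_dir_sym i i2 j j2 : same_dir i i2 j j2 -> same_dir j j2 i i2.
Proof. by case=> *; split. Qed.

Lemma same_dir_swap i i2 j j2 : same_dir i i2 j j2 -> same_dir i2 i j2 j.
Proof. by case=> *; split. Qed.

Section Bisim.
Variable S : Type.
Implicit Types w : word S.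

Lemma bisim_refl r w i : bisim r w i w i.
Proof.
elim: r i => [|r IH] i; split=> //.
by split=> k; exists k => //; split.
Qed.

Lemma bisim_sym r w w' i j : bisim r w i w' j -> bisim r w' j w i.
Proof.
elim: r i j => [|r IH] i j [e H]; split=> //.
case: H => H1 H2; split=> k.
  by have [l /same_dir_sym ? /IH ?] := H2 k; exists l.
by have [l /same_dir_sym ? /IH ?] := H1 k; exists l.
Qed.

Lemma bisim_trans r w1 w2 w3 i j k :
  bisim r w1 i w2 j -> bisim r w2 j w3 k -> bisim r w1 i w3 k.
Proof.
elim: r i j k => [|r IH] i j k [e H] [e' H']; split; rewrite ?e //.
case: H => F B; case: H' => F' B'; split=> l.
  have [l' d b] := F l; have [l'' d' b'] := F' l'.
  by exists l''; [case: d; case: d'; rewrite /same_dir => -> -> -> -> | exact: IH b b'].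
have [l' d b] := B' l; have [l'' d' b'] := B l'.
by exists l''; [case: d; case: d'; rewrite /same_dir => <- <- <- <- | exact: IH b' b].
Qed.

Lemma bisimW r w w' i j : bisim r.+1 w i w' j -> bisim r w i w' j.
Proof.
case=> _ [F _]; have [j2 [d1 d2 _ _]] := F i.
by suff -> : j2 = j by []; lia.
Qed.

Lemma bisim_succ r w w' i j :
  bisim r.+1 w i w' j -> bisim r w i.+1 w' j.+1.
Proof.
case=> _ [F _]; have [j2 [_ _ d3 _]] := F i.+1.
by suff -> : j2 = j.+1 by []; lia.
Qed.

Lemma bisim_after r w w' i j i2 : bisim r.+1 w i w' j -> i < i2 ->
  exists2 j2, j < j2 /\ (i.+1 < i2) = (j.+1 < j2) & bisim r w i2 w' j2.
Proof.
case=> _ [F _] lt_i; have [j2 [d1 d2 d3 d4] b] := F i2.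
by exists j2 => //; lia.
Qed.

Lemma bisim_before r w w' i j i2 : bisim r.+1 w i w' j -> i2 < i ->
  exists2 j2, j2 < j & bisim r w i2 w' j2.
Proof.
case=> _ [F _] lt_i; have [j2 [d1 d2 d3 d4] b] := F i2.
by exists j2 => //; lia.
Qed.

(* Deletes the positions p+1, ..., q. *)
Definition cut_pos (p q i : nat) : nat := if i <= p then i else i + (q - p).

Lemma cut_posP p q i :
  (i <= p /\ cut_pos p q i = i) \/ (p < i /\ cut_pos p q i = i + (q - p)).
Proof. by rewrite /cut_pos; case: leqP; [left | right]. Qed.

(** Each position is matched with its original, so that most moves can be copied; the equivalence of
    [p] and [q] repairs moves across the seam or into the deleted factor. *)
Lemma bisim_cut r w p q : p < q -> bisim r w p w q ->
  forall j, bisim r (w \o cut_pos p q) j w (cut_pos p q j).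
Proof.
move=> ltpq; elim: r => [|r IH] bpq j; first by split.
have {}IH := IH (bisimW bpq); split=> //; split=> [j2|i2].
  have := cut_posP p q j; have := cut_posP p q j2.
  set c := cut_pos p q j; set c2 := cut_pos p q j2 => ec2 ec.
  (* In the cut word [p] and [p.+1] are neighbours, whereas their originals [p] and [q.+1] are not;
     the answer [p.+1] has the same type as [q.+1]. *)
  case: (boolP ((j == p) && (j2 == p.+1))) => [/andP[/eqP ej /eqP ej2]|Nup].
    exists p.+1; first by rewrite /same_dir; split; lia.
    apply: bisim_trans (IH _) _; rewrite -/c2 (_ : c2 = q.+1); last by lia.
    exact/bisim_succ/bisim_sym.
  case: (boolP ((j == p.+1) && (j2 == p))) => [/andP[/eqP ej /eqP ej2]|Ndn].
    exists q; first by rewrite /same_dir; split; lia.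
    apply: bisim_trans (IH _) _; rewrite -/c2 (_ : c2 = p); last by lia.
    exact: bisimW.
  by exists c2 => //; rewrite /same_dir; split; lia.
have wit j2 i3 : cut_pos p q j2 = i3 -> same_dir j j2 (cut_pos p q j) i2 ->
    bisim r w i3 w i2 ->
  exists2 j2, same_dir j j2 (cut_pos p q j) i2
            & bisim r (w \o cut_pos p q) j2 w i2.
  by move=> <- d b; exists j2 => //; apply: bisim_trans (IH _) b.
have stay i3 : i3 <= p -> cut_pos p q i3 = i3.
  by have := cut_posP p q i3; lia.
have back i3 : q < i3 -> cut_pos p q (i3 - (q - p)) = i3.
  by have := cut_posP p q (i3 - (q - p)); lia.
have := cut_posP p q j; move: wit; set c := cut_pos p q j => wit ec.
have [lejp|ltpj] := leqP j p.
  have [lei2|lti2] := leqP i2 p.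
    apply: wit (stay _ lei2) _ (bisim_refl _ _ _).
    by rewrite /same_dir; split; lia.
  have [ltqi|leiq] := boolP ((q < i2) && ~~ ((j == p) && (i2 == q.+1))).
    have lt2 : q < i2 by lia.
    apply: wit (back _ lt2) _ (bisim_refl _ _ _).
    by rewrite /same_dir; split; lia.
  (* Left are targets in the deleted factor and, from [p], the target [q.+1]. The move from [p] to
     [i2] is replayed from [q], where its target survives the cut. *)
  have [i3 [lt3 lt3'] b] := bisim_after bpq lti2.
  apply: wit (back _ lt3) _ (bisim_sym b).
  have : p.+1 < i2 \/ i2 = p.+1 by lia.
  rewrite /same_dir; case=> ?; split; lia.
have [ltqi|leiq] := ltnP q i2.
  apply: wit (back _ ltqi) _ (bisim_refl _ _ _).
  by rewrite /same_dir; split; lia.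
have [eq2|neq] := eqVneq i2 q.
  apply: wit (stay _ (leqnn _)) _ _; last by rewrite eq2; exact: bisimW.
  by rewrite /same_dir; split; lia.
have lti2 : i2 < q by lia.
have [i3 lt3 b] := bisim_before (bisim_sym bpq) lti2.
apply: wit (stay _ (ltnW lt3)) _ (bisim_sym b).
by rewrite /same_dir; split; lia.
Qed.

End Bisim.

(** A quantifier over one variable is a move of the game from the position of the other, which stays
    in place. *)
Lemma bisim_sat (P : finType) (phi : fo2 P) r (w w' : word {set P}) e e' :
  qdepth phi <= r -> (forall v, bisim r w (e v) w' (e' v)) ->
  same_dir (e VX) (e VY) (e' VX) (e' VY) ->
  sat w e phi <-> sat w' e' phi.
Proof.
have step v r' (w1 w2 : word {set P}) (e1 e2 : var -> nat) :
    (forall v, bisim r'.+1 w1 (e1 v) w2 (e2 v)) -> forall n, exists n',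
    (forall v', bisim r' w1 (update e1 v n v') w2 (update e2 v n' v')) /\
    same_dir (update e1 v n VX) (update e1 v n VY)
             (update e2 v n' VX) (update e2 v n' VY).
  move=> b n; case: v; rewrite /update /=.
    have [_ [F _]] := b VY; have [n' d bn] := F n; exists n'; split.
      by case=> //=; apply: bisimW.
    exact: same_dir_swap.
  have [_ [F _]] := b VX; have [n' d bn] := F n; exists n'; split=> //.
  by case=> //=; apply: bisimW.
elim: phi r w w' e e' => [p v|u v|u v|u v|f IH|f IHf g IHg|f IHf g IHg|v f IH|v f IH]
  r w w' e e' /= ler b d.
- by have := b v; case: (r) => [|?] [-> _].
- by case: d => d1 d2 d3 d4; case: u; case: v; lia.
- by case: d => d1 d2 d3 d4; case: u; case: v; lia.
- by case: d => d1 d2 d3 d4; case: u; case: v; lia.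
- by have [? ?] := IH _ _ _ _ _ ler b d; split; auto.
- have [lea leb] : qdepth f <= r /\ qdepth g <= r by lia.
  have := IHf _ _ _ _ _ lea b d; have := IHg _ _ _ _ _ leb b d; tauto.
- have [lea leb] : qdepth f <= r /\ qdepth g <= r by lia.
  have := IHf _ _ _ _ _ lea b d; have := IHg _ _ _ _ _ leb b d; tauto.
- case: r ler b => // r ler b; split=> -[n sn].
    have [n' [b' d']] := step v _ _ _ _ _ b n; exists n'.
    by apply/(IH _ _ _ _ _ ler b' d').
  have [n' [b' d']] := step v _ _ _ _ _ (fun v => bisim_sym (b v)) n; exists n'.
  by apply/(IH _ _ _ _ _ ler b' d').
- case: r ler b => // r ler b; split=> sn n.
    have [n' [b' d']] := step v _ _ _ _ _ (fun v => bisim_sym (b v)) n.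
    by apply/(IH _ _ _ _ _ ler b' d').
  have [n' [b' d']] := step v _ _ _ _ _ b n.
  by apply/(IH _ _ _ _ _ ler b' d').
Qed.

(** * Short representatives of prefixes *)

Fixpoint catw (S : Type) (u : seq S) (v : word S) : word S :=
  if u is a :: u' then fun n => if n is m.+1 then catw u' v m else a else v.

Section CatWord.
Variable S : Type.
Implicit Types (u : seq S) (v : word S).

Lemma catw_lt x0 u v i : i < size u -> catw u v i = nth x0 u i.
Proof. by elim: u i => //= a u IH [|i] //=; exact: IH. Qed.

Lemma catw_ge u v i : size u <= i -> catw u v i = v (i - size u).
Proof. by elim: u i => [|a u IH] [|i] //=; exact: IH. Qed.

Lemma catw_cat u1 u2 v : catw (u1 ++ u2) v = catw u1 (catw u2 v).
Proof. by elim: u1 => //= a u1 ->. Qed.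

Lemma catw_cut u v p q : p < q < size u ->
  catw (take p.+1 u ++ drop q.+1 u) v = catw u v \o cut_pos p q.
Proof.
move=> /andP[ltpq ltqu]; apply/funext => i /=.
have x0 : S by case: u ltqu.
have szt : size (take p.+1 u) = p.+1 by rewrite size_take; case: ltnP; lia.
have := cut_posP p q i; case=> -[lei ->].
  by rewrite catw_cat !(catw_lt x0) ?szt ?nth_take //; lia.
rewrite catw_cat catw_ge szt //.
have [lt|ge] := ltnP (i - p.+1) (size (drop q.+1 u)).
  rewrite !(catw_lt x0) ?nth_drop //.
    by congr nth; lia.
  by move: lt; rewrite size_drop; lia.
move: ge; rewrite size_drop => ge.
by rewrite !catw_ge ?size_drop //; try congr v; lia.
Qed.

End CatWord.

(** The set of marks up to [i] grows with [i], so equal sizes force equal sets: a count encodes the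
    place relative to all marks. *)
Lemma same_side (C : seq nat) i j :
  count (fun c => c <= i) C = count (fun c => c <= j) C ->
  forall c, c \in C -> (c <= i) = (c <= j).
Proof.
wlog leij : i j / i <= j => [W|].
  have [/W //|/ltnW /W {}W] := leqP i j.
  by move=> e c cC; rewrite [RHS]W.
elim: C => //= c C IH e c'.
have le1 : count (fun c => c <= i) C <= count (fun c => c <= j) C.
  by apply: sub_count => x; lia.
rewrite inE => /orP[/eqP->|]; first by lia.
by apply: IH; lia.
Qed.

Lemma extremal_positions (Q : pred nat) n : exists lo hi, forall i,
  i < n -> Q i -> [/\ lo <= i <= hi, lo < n, hi < n, Q lo & Q hi].
Proof.
have [exQ|noQ] := pselect (exists i, (i < n) && Q i); last first.
  by exists 0, 0 => i ltin Qi; case: noQ; exists i; rewrite ltin.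
have bnd i : (i < n) && Q i -> i <= n by case/andP => /ltnW.
have [lo /andP[lo1 lo2] loP] := ex_minnP exQ.
have [hi /andP[hi1 hi2] hiP] := ex_maxnP exQ bnd.
exists lo, hi => i ltin Qi; split=> //.
by rewrite loP ?hiP ?ltin.
Qed.

(** * Marks, colours and cutting in a finite word *)

Section Shrink.
Variables (S : finType) (K : nat).

Section Windows.
Variable u : seq S.

(** The [K] blanks in front move letter [i] to index [i + K], so windows at the left border need no
    subtraction. *)
Definition padded (i : nat) : option S :=
  nth None (nseq K None ++ map Some u) i.

(* The letters at distance at most K from position i, None standing for the
   positions outside u. *)
Definition window (i : nat) : {ffun 'I_(2 * K).+1 -> option S} :=
  [ffun d : 'I_(2 * K).+1 => padded (i + d)].

Definition eq_window (r i j : nat) : Prop :=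
  forall d, K <= d + r -> d <= K + r -> padded (i + d) = padded (j + d).

Lemma padded_letter v i : i < size u -> padded (i + K) = Some (catw u v i).
Proof.
move=> ltiu; have x0 : S by case: u ltiu.
rewrite /padded nth_cat size_nseq ltnNge leq_addl /= addnK.
by rewrite (nth_map x0) // (catw_lt x0).
Qed.

Lemma padded_None i : (padded i == None) = (i < K) || (K + size u <= i).
Proof.
rewrite /padded nth_cat size_nseq nth_nseq; case: ltnP => //= leKi.
have [ge|lt] := leqP (K + size u) i.
  by rewrite nth_default // size_map; lia.
have x0 : S by case: u lt => //=; lia.
by rewrite (nth_map x0) //; lia.
Qed.

Lemma window_eq r i j : r <= K -> window i = window j -> eq_window r i j.
Proof.
move=> lerK /ffunP e d d1 d2.
have ltd : d < (2 * K).+1 by lia.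
by have := e (Ordinal ltd); rewrite !ffunE.
Qed.

Definition color (C : seq nat) (i : nat) :
    {ffun 'I_(2 * K).+1 -> option S} * 'I_(size C).+1 :=
  (window i, inord (count (fun c => c <= i) C)).

Lemma color_side C i j : color C i = color C j ->
  forall c, c \in C -> (c <= i) = (c <= j).
Proof.
case=> _ /(congr1 val) /=; rewrite !inordK ?ltnS ?count_size //.
exact: same_side.
Qed.

Definition num_windows : nat := #|{ffun 'I_(2 * K).+1 -> option S}|.

(** Moves to a neighbour keep the place relative to the old marks because the shifted marks are
    marks too; far moves go to the first or last position of the target's class. *)
Lemma marks_exist r : r <= K -> exists2 C : seq nat,
  (size C).+1 <= (2 * num_windows + 3) ^ r &
  forall v i j, i < size u -> j < size u -> eq_window r i j ->
    (forall c, c \in C -> (c <= i) = (c <= j)) ->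
    bisim r (catw u v) i (catw u v) j.
Proof.
elim: r => [_|r IH ltrK].
  exists [::] => // v i j ltiu ltju e _; split=> //.
  have := e K (leq_addr _ _) (leq_addr _ _).
  by rewrite !(padded_letter v) // => -[].
have [C szC bC] := IH (ltnW ltrK).
have [lo /fin_all_exists[hi ext]] :=
  fin_all_exists (fun x => extremal_positions (fun i => color C i == x) (size u)).
have [X memX szX] : exists2 X : seq
    ({ffun 'I_(2 * K).+1 -> option S} * 'I_(size C).+1),
    forall x, x \in X & size X = num_windows * (size C).+1.
  exists (enum {: {ffun 'I_(2 * K).+1 -> option S} * 'I_(size C).+1}).
    by move=> x; rewrite mem_enum.
  by rewrite -cardE card_prod card_ord.
(* [(lo x).+2 <= i] says that [lo x] is far left of [i], and [(hi x).-1 <= i] that [hi x] is not far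
   right. From s marks this makes 3s + 2W(s + 1), and one more is at most (2W + 3)(s + 1). *)
exists (C ++ map succn C ++ map predn C ++
        [seq (lo x).+2 | x <- X] ++ [seq (hi x).-1 | x <- X]).
  rewrite !size_cat !size_map szX expnS.
  nia.
move=> v.
have half i j : i < size u -> j < size u -> eq_window r.+1 i j ->
    (forall c, c \in C ++ map succn C ++ map predn C ++
        [seq (lo x).+2 | x <- X] ++ [seq (hi x).-1 | x <- X] ->
      (c <= i) = (c <= j)) ->
    forall i2, exists2 j2, same_dir i i2 j j2
      & bisim r (catw u v) i2 (catw u v) j2.
  move=> ltiu ltju eqw side i2.
  have sideC c : c \in C -> [/\ (c <= i) = (c <= j), (c.+1 <= i) = (c.+1 <= j)
      & (c.-1 <= i) = (c.-1 <= j)].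
    by move=> cC; split; apply: side; rewrite !mem_cat ?map_f ?cC ?orbT.
  have sidelo x : ((lo x).+2 <= i) = ((lo x).+2 <= j).
    by apply: side; rewrite !mem_cat (map_f (fun x => (lo x).+2)) ?memX ?orbT.
  have sidehi x : ((hi x).-1 <= i) = ((hi x).-1 <= j).
    by apply: side; rewrite !mem_cat (map_f (fun x => (hi x).-1)) ?memX ?orbT.
  have [->|neij] := eqVneq i j; first by exists i2 => //; exact: bisim_refl.
  (* The windows have radius at least 1, so they show whether a position is the first or the
     last. *)
  have eq0 : (i == 0) = (j == 0).
    have := padded_None (i + K.-1); have := padded_None (j + K.-1).
    by rewrite (eqw K.-1); lia.
  have eqn : (i.+1 == size u) = (j.+1 == size u).
    have := padded_None (i + K.+1); have := padded_None (j + K.+1).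
    by rewrite (eqw K.+1); lia.
  have sameC k l : k < size u -> l < size u -> color C k = color C l ->
      bisim r (catw u v) k (catw u v) l.
    move=> ltk ltl e; apply: bC => //; last exact: color_side.
    by apply: window_eq; [exact: ltnW | case: e].
  (* Two last positions would coincide, so an [i2] past the end is far right of both [i] and [j]. *)
  have [gei2|lti2] := leqP (size u) i2.
    by exists i2; [split; lia | exact: bisim_refl].
  have [eqi2|nei2] := eqVneq i2 i.
    exists j; first by split; lia.
    rewrite eqi2; apply: bC => // [d d1 d2|c /sideC[]//].
    by apply: eqw; lia.
  have [eqi2'|nei2'] := eqVneq i2 i.+1.
    exists j.+1; first by split; lia.
    rewrite eqi2'; apply: bC => [||d d1 d2|c /sideC[]]; try lia.
    by rewrite !addSnnS; apply: eqw; lia.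
  have [eqi2''|nei2''] := eqVneq i i2.+1.
    exists j.-1; first by split; lia.
    apply: bC => [||d d1 d2|c /sideC[]]; try lia.
    have -> : i2 + d = i + d.-1 by lia.
    have -> : j.-1 + d = j + d.-1 by lia.
    by apply: eqw; lia.
  have [bnds ltlo lthi /eqP elo /eqP ehi] :=
    ext (color C i2) i2 lti2 (eqxx _).
  have := sidelo (color C i2); have := sidehi (color C i2).
  have [ltii2|leii2] := ltnP i i2 => shi slo.
    by exists (hi (color C i2)); [split; lia | exact: sameC].
  by exists (lo (color C i2)); [split; lia | exact: sameC].
move=> i j ltiu ltju eqw side; split; last split.
- have := eqw K (leq_addr _ _) (leq_addr _ _).
  by rewrite !(padded_letter v) // => -[].
- exact: half.
- move=> j2; have [||||i2 d b] := half j i _ _ _ _ j2 => //.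
  + by move=> d d1 d2; rewrite eqw.
  + by move=> c /side.
  by exists i2; [exact: same_dir_sym | exact: bisim_sym].
Qed.

End Windows.
Definition short_bound : nat := num_windows * (2 * num_windows + 3) ^ K.

(** Pigeonhole: there are more positions than colours, and the factor between two positions of one
    colour can be cut out. *)
Lemma shorten_word (u : seq S) : short_bound < size u ->
  exists2 u', size u' < size u &
    forall v, bisim K (catw u' v) 0 (catw u v) 0.
Proof.
move=> ltu; have [C szC bC] := marks_exist u (leqnn K).
have /injectivePn[i [j neij /= eqc]] :
    ~~ injectiveb (fun i : 'I_(size u) => color u C i).
  apply/negP => /injectiveP /leq_card; rewrite card_prod !card_ord => le.
  have : size u <= short_bound; last by lia.
  by apply: leq_trans le _; rewrite leq_mul2l szC orbT.
wlog ltij : i j neij eqc / i < j => [W|].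
  have [|ltji|eqij] := ltngtP i j; first exact: W neij eqc.
    by apply: W (esym eqc) ltji; rewrite eq_sym.
  by rewrite (val_inj eqij) eqxx in neij.
exists (take i.+1 u ++ drop j.+1 u).
  have ltj := ltn_ord j.
  by rewrite size_cat size_takel ?size_drop; lia.
move=> v; rewrite catw_cut ?ltij ?ltn_ord //.
rewrite -[X in bisim _ _ _ _ X](_ : cut_pos i j 0 = 0) //.
apply: bisim_cut => //; apply: bC => //; last exact: color_side eqc.
by apply: window_eq => //; case: eqc.
Qed.

Lemma short_word (u : seq S) : exists2 u', size u' <= short_bound &
  forall v, bisim K (catw u' v) 0 (catw u v) 0.
Proof.
have [n] := ubnP (size u); elim: n u => // n IH u ltun.
have [leu|/shorten_word[u1 lt1 b1]] := leqP (size u) short_bound.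
  by exists u => // v; exact: bisim_refl.
have [u2 le2 b2] := IH u1 (leq_trans lt1 ltun).
by exists u2 => // v; exact: bisim_trans (b2 v) (b1 v).
Qed.

End Shrink.

(** * Dependence on the recurring factors *)

Definition factor (S : Type) (m : nat) (w : word S) (i : nat) : m.-tuple S :=
  [tuple w (i + d) | d < m].

Section Tail.
Variables (S : finType) (K : nat).
Implicit Types (w : word S) (F : {set (2 * K).+1.-tuple S}).
Local Notation fac := (@factor S (2 * K).+1).

Definition eq_around (r : nat) w i w' j : Prop :=
  forall d, d <= r -> w (i + d) = w' (j + d) /\ w (i - d) = w' (j - d).

Lemma factor_eq_around r w i w' j : r <= K -> K <= i -> K <= j ->
  fac w (i - K) = fac w' (j - K) -> eq_around r w i w' j.
Proof.
move=> lerK leKi leKj e d ledr.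
have fe l : l < (2 * K).+1 -> w (i - K + l) = w' (j - K + l).
  move=> ltl; have := congr1 (fun s => tnth s (Ordinal ltl)) e.
  by rewrite !tnth_mktuple.
split.
  by have := fe (K + d); rewrite !addnA !subnK //; apply; lia.
have := fe (K - d); rewrite !addnBA; try lia.
by rewrite !subnK //; apply; lia.
Qed.

(** * The game on tails with the same recurring factors *)

Section Thresholds.
Variables (F : {set (2 * K).+1.-tuple S}) (t : nat -> nat).
Hypotheses (t0 : K <= t 0) (t_incr : forall r, t r < t r.+1).

Lemma threshold_mono r r' : r <= r' -> t r <= t r'.
Proof.
by move/subnK <-; elim: (r' - r) => // n IH; exact: leq_trans IH (ltnW _).
Qed.

(** Thresholds bound the centres [i + K] of factors. Recurrence answers moves to the far right; the
    occurrences between consecutive thresholds answer moves to the far left. *)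
Definition tame w : Prop :=
  [/\ forall i, t 0 <= i + K -> fac w i \in F,
      forall s, s \in F -> inf_often (fun i => fac w i = s)
    & forall s r, s \in F -> r < K ->
        exists i, [/\ t r <= i + K, (i + K).+1 < t r.+1 & fac w i = s]].

(** Game invariant with [r] rounds left; every round costs one threshold and one unit of radius. *)
Definition close (r : nat) w i w' j : Prop :=
  i = j /\ i < t r \/ [/\ t r <= i, t r <= j & eq_around r w i w' j].

Lemma close_sym r w i w' j : close r w i w' j -> close r w' j w i.
Proof.
case=> [[-> lt]|[? ? e]]; [by left | right; split=> // d led].
by have [-> ->] := e d led.
Qed.

Lemma close_step w w' r i j : tame w -> tame w' ->
  (forall l, l <= t K + K -> w l = w' l) -> r < K ->
  close r.+1 w i w' j ->
  forall i2, exists2 j2, same_dir i i2 j j2 & close r w i2 w' j2.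
Proof.
move=> [Fw _ _] [_ infw' betw'] agree ltrK cl i2.
have ltr := t_incr r; have leK := threshold_mono ltrK.
have ler := threshold_mono (leq0n r).
have [lt2|ge2] := ltnP i2 (t r).
  by exists i2; [case: cl => [[]|[]]; split; lia | left].
have Fi2 : fac w (i2 - K) \in F by apply: Fw; lia.
have far l : t r <= l + K -> fac w' l = fac w (i2 - K) ->
    close r w i2 w' (l + K).
  move=> lel e; right; split=> //.
  by apply: factor_eq_around; rewrite ?addnK //; lia.
have [lt|le] := ltnP i.+1 i2.
  have [l lel e] := infw' _ Fi2 (j.+2 + t r).
  by exists (l + K); [split; lia | apply: far => //; lia].
(* From a common position below [t r.+1], a move that is not far right stays where the two words
   agree. *)
case: cl => [[<- lti]|[lei lej e]].
  exists i2 => //; right; split=> // d led.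
  by split; apply: agree; lia.
(* The occurrence found below [t r.+1] leaves one position spare before [j], so it lies far left. *)
have [lt'|le'] := ltnP i2.+1 i.
  have [l [l1 l2 l3]] := betw' _ _ Fi2 ltrK.
  by exists (l + K); [split; lia | exact: far].
have : [\/ i2 = i, i2 = i.+1 | i = i2.+1].
  have : i2 = i \/ i2 = i.+1 \/ i = i2.+1 by lia.
  by case=> [|[]]; [constructor 1 | constructor 2 | constructor 3].
case=> ei.
- exists j; first by split; lia.
  by right; split=> [||d led]; rewrite ?ei; try lia; apply: e; lia.
- exists j.+1; first by split; lia.
  right; split=> [||[|d] led]; try lia.
    by have [] := e 1 isT; rewrite ei !addn1 !addn0 !subn0.
  have [e1 _] := e d.+2 led; have [_ e2] := e d (ltnW (leqW led)).
  rewrite ei; split; last by rewrite !subSS.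
  by rewrite !addSnnS.
- exists j.-1; first by split; lia.
  right; split=> [||d led]; try lia.
  have [_ e2] := e d.+1 led.
  have e2' : w (i2 - d) = w' (j.-1 - d).
    have -> : i2 - d = i - d.+1 by lia.
    by have -> : j.-1 - d = j - d.+1 by lia.
  split=> //; case: d led {e2} e2' => [|d] led e2'.
    by move: e2'; rewrite !addn0 !subn0.
  have [e3 _] := e d (ltnW (leqW led)).
  have -> : i2 + d.+1 = i + d by lia.
  by have -> : j.-1 + d.+1 = j + d by lia.
Qed.

Lemma close_bisim w w' r i j : tame w -> tame w' ->
  (forall l, l <= t K + K -> w l = w' l) -> r <= K ->
  close r w i w' j -> bisim r w i w' j.
Proof.
move=> tw tw' agree; elim: r i j => [|r IH] i j ltrK cl.
  split=> //; case: cl => [[<- lti]|[_ _ /(_ 0 isT)[]]].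
    by apply: agree; have := threshold_mono ltrK; lia.
  by rewrite !addn0.
split; last split.
- case: cl => [[<- lti]|[_ _ /(_ 0 isT)[]]].
    by apply: agree; have := threshold_mono ltrK; lia.
  by rewrite !addn0.
- move=> i2; have [j2 d c] := close_step tw tw' agree ltrK cl i2.
  by exists j2 => //; apply: IH => //; exact: ltnW.
- have agree' l : l <= t K + K -> w' l = w l by move/agree.
  move=> j2.
  have [i2 d c] := close_step tw' tw agree' ltrK (close_sym cl) j2.
  by exists i2; [exact: same_dir_sym | apply: IH (ltnW ltrK) (close_sym c)].
Qed.

End Thresholds.

(** The thresholds are read off [w]; agreement up to [t K + K] gives [w'] the same occurrences
    between them. *)
Lemma tail_bisim w F n0 :
  (forall i, n0 <= i -> fac w i \in F) ->
  (forall s, s \in F -> inf_often (fun i => fac w i = s)) ->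
  exists n1, forall w', (forall i, i <= n1 -> w i = w' i) ->
    (forall i, n0 <= i -> fac w' i \in F) ->
    (forall s, s \in F -> inf_often (fun i => fac w' i = s)) ->
    bisim K w 0 w' 0.
Proof.
move=> Fw infw.
(* After [a], every factor of [F] occurs before [B a]; iterating [B] yields the thresholds. *)
have /choice[B HB] : forall a, exists b, a < b /\
    forall s, s \in F -> exists i, [/\ a <= i, (i + K).+1 < b & fac w i = s].
  move=> a.
  have /fin_all_exists[f Hf] s : exists i, s \in F -> a <= i /\ fac w i = s.
    have [sF|] := boolP (s \in F); last by exists 0.
    by have [i] := infw s sF a; exists i.
  exists (a + (\max_s f s) + K + 2); split=> [|s sF]; first by lia.
  have [? ?] := Hf s sF; exists (f s); split=> //.
  by have := @leq_bigmax _ f s; lia.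
pose t r := iter r B (n0 + K).+1.
have t0 : K <= t 0 by rewrite /t /=; lia.
have t_incr r : t r < t r.+1 by have [] := HB (t r).
have mono := threshold_mono t_incr.
exists (t K + K) => w' agree Fw' infw'.
have tw : tame F t w.
  split=> // [i lei|s r sF _]; first by apply: Fw; move: lei; rewrite /t /=; lia.
  have [_ /(_ s sF)[i [i1 i2 i3]]] := HB (t r).
  by exists i; split=> //; lia.
have tw' : tame F t w'.
  split=> // [i lei|s r sF ltrK]; first by apply: Fw'; move: lei; rewrite /t /=; lia.
  have [_ _ /(_ s r sF ltrK)[i [i1 i2 <-]]] := tw.
  exists i; split=> //; apply: eq_from_tnth => d; rewrite !tnth_mktuple.
  by apply/esym/agree; have := mono _ _ ltrK; have := ltn_ord d; lia.
apply: (close_bisim t0 t_incr tw tw' agree (leqnn K)).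
by left; split=> //; have := mono 0 K (leq0n K); rewrite {1}/t /=; lia.
Qed.

End Tail.

(** * The automaton *)

(* g y collects the values seen since the last occurrence of y, so that when y
   recurs infinitely often, the hit set of y is eventually contained in the
   set of recurrent values, and equals it infinitely often. *)
Definition record_seen (X : finType) (g : {ffun X -> {set X}}) (x : X) :=
  [ffun y => if y == x then [set x] else x |: g y].

(** * Recovering the recurrent values of a sequence *)

Section Recurrence.
Variables (X : finType) (x : nat -> X) (g : nat -> {ffun X -> {set X}}).
Hypothesis gS : forall n, g n.+1 = record_seen (g n) (x n.+1).

Definition recurrent : {set X} := [set s | `[< inf_often (fun n => x n = s) >]].

(** The entry is read from [g n], before the current value resets it; index [n] describes time
    [n.+1]. *)
Definition hit (n : nat) : {set X} := x n.+1 |: g n (x n.+1).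

Lemma recurrentP s : reflect (inf_often (fun n => x n = s)) (s \in recurrent).
Proof. by rewrite inE; exact: asboolP. Qed.

Lemma eventually_recurrent : exists N, forall n, N <= n -> x n \in recurrent.
Proof.
have /fin_all_exists[f Hf] s :
    exists N, s \notin recurrent -> forall n, N <= n -> x n != s.
  have [|/recurrentP/asboolPn] := boolP (s \in recurrent); first by exists 0.
  rewrite /inf_often => /asboolPn /existsNP[N nN]; exists N => _ n len.
  by apply/eqP => xn; apply: nN; exists n.
exists (\max_s f s) => n len; apply: contraT => nF.
have := Hf _ nF n; rewrite eqxx; apply.
by apply: leq_trans len; exact: leq_bigmax.
Qed.

Lemma seen_since N n y : (forall l, N < l <= n -> x l != y) ->
  forall l, N < l <= n -> x l \in g n y.
Proof.
elim: n => [|n IH] nseen l lel; first by lia.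
rewrite gS ffunE ifN_eqC; last by apply: nseen; lia.
have [->|nel] := eqVneq l n.+1; first by rewrite setU11.
by rewrite setU1r ?IH // => [l' lel'|]; [apply: nseen|]; lia.
Qed.

Lemma seen_sub (F : {set X}) N n y :
  (forall l, N < l -> x l \in F) -> (exists2 l, N < l <= n & x l = y) ->
  g n y \subset F.
Proof.
move=> xF; elim: n => [|n IH] [l lel xl]; first by lia.
have xnF : N < n.+1 by lia.
rewrite gS ffunE; case: eqVneq => [_|neq].
  by rewrite sub1set xF.
rewrite subUset sub1set xF //=; apply: IH; exists l => //.
have : l != n.+1 by apply: contra_neq neq => <-.
lia.
Qed.

(** Once each recurrent value has occurred after [N0], its entry has been reset there and collects
    only recurrent values. *)
Lemma hit_sub_recurrent : exists N, forall n, N <= n -> hit n \subset recurrent.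
Proof.
have [N0 xF] := eventually_recurrent.
have /fin_all_exists[f Hf] s :
    exists l, s \in recurrent -> N0 < l /\ x l = s.
  have [/recurrentP/(_ N0.+1)[l lel xl]|] := boolP (s \in recurrent).
    by exists l.
  by exists 0.
exists (N0 + \max_s f s) => n len.
have xnF : x n.+1 \in recurrent by apply: xF; lia.
rewrite /hit subUset sub1set xnF; apply: (@seen_sub _ N0).
  by move=> l /ltnW; exact: xF.
have [ltf xf] := Hf _ xnF; exists (f (x n.+1)) => //.
by have := @leq_bigmax _ f (x n.+1); lia.
Qed.

(** Take the recurrent value whose first occurrence after [n] comes last: by then all others have
    occurred after [n], with no reset of its entry in between. *)
Lemma hit_recurrent_sub : inf_often (fun n => recurrent \subset hit n).
Proof.
move=> n; have [N0 xF] := eventually_recurrent.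
have exm s : s \in recurrent -> exists l, (n < l) && (x l == s).
  by move/recurrentP/(_ n.+1) => [l ltl <-]; exists l; rewrite ltl eqxx.
have /fin_all_exists[f Hf] s : exists l, s \in recurrent ->
    [/\ n < l, x l = s & forall l', n < l' -> x l' = s -> l <= l'].
  have [/exm ex|] := boolP (s \in recurrent); last by exists 0.
  have [l /andP[ltnl /eqP xl] lP] := ex_minnP ex.
  by exists l => _; split=> // l' lt' x'; apply: lP; rewrite lt' x' eqxx.
have [y yF ymax] := arg_maxnP f (xF _ (leqnn N0)).
have [ltny xy ymin] := Hf _ yF.
exists (f y).-1; first by lia.
apply/subsetP => s sF; rewrite /hit prednK; last by lia.
rewrite xy !inE; case: eqVneq => //= neq.
have [ltns xs smin] := Hf _ sF; rewrite -xs.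
have /= := ymax _ sF; have : f s != f y by apply: contra_neq neq => e; rewrite -xs -xy e.
move=> ne le; apply: (@seen_since n) => [l lel|]; last by lia.
have [ltnl lel'] := andP lel.
by apply/eqP => xl; have := ymin l ltnl xl; lia.
Qed.

Lemma hit_recurrent : inf_often (fun n => hit n = recurrent).
Proof.
move=> n; have [N subF] := hit_sub_recurrent.
have [l lel Fsub] := hit_recurrent_sub (n + N).
exists l; first by lia.
by apply/eqP; rewrite eqEsubset Fsub subF //; lia.
Qed.

End Recurrence.

Lemma card_set_type (T : finType) : #|{set T}| = 2 ^ #|T|.
Proof. by rewrite -[LHS]cardsT -powersetT card_powerset cardsT. Qed.

(** * Construction and correctness of the automaton *)

Section Automaton.
Variables (S : finType) (x0 : S) (K : nat) (L : word S -> Prop).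
Hypothesis L_bisim : forall w w', bisim K w 0 w' 0 -> L w -> L w'.
Variable rep : seq S -> {bseq short_bound S K of S}.
Hypothesis rep_bisim : forall u v, bisim K (catw (rep u) v) 0 (catw u v) 0.

Local Notation m := (2 * K).+1.
Local Notation fac := (@factor S m).

Lemma factor_ext w i w' j : (forall d, d < m -> w (i + d) = w' (j + d)) ->
  fac w i = fac w' j.
Proof. by move=> e; apply: eq_from_tnth => d; rewrite !tnth_mktuple e. Qed.

Definition shift (x : m.-tuple S) (a : S) : m.-tuple S :=
  [tuple of behead (rcons x a)].

(** The window [x] supplies the letters of factors straddling the border; the factor at 0 is [x]
    itself, already read, hence [i.+1]. *)
Definition continuation (x : m.-tuple S) (T : {set m.-tuple S}) (v : word S) :=
  (forall i, fac (catw x v) i.+1 \in T) /\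
  (forall s, s \in T -> inf_often (fun i => fac (catw x v) i = s)).

(** For a long prefix and [T] the recurrent set, all continuations give the same answer, so asking
    for one is enough. *)
Definition verdict (u : seq S) (x : m.-tuple S) (T : {set m.-tuple S}) : bool :=
  `[< exists2 v, continuation x T v & L (catw u v) >].

Definition tracker : finType :=
  ({bseq short_bound S K of S} * m.-tuple S *
   {ffun m.-tuple S -> {set m.-tuple S}} * {set m.-tuple S})%type.

Definition tracker_init : tracker :=
  (rep [::], nseq_tuple m x0, [ffun=> set0], set0).

Definition tracker_step (q : tracker) (a : S) : tracker :=
  let: (u, x, g, _) := q in
  let y := shift x a in
  (rep (rcons u a), y, record_seen g y, y |: g y).

Definition tracker_prio (q : tracker) : nat :=
  let: (u, x, _, T) := q in 2 * #|T| + ~~ verdict u x T.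

Definition tracker_dpa : dpa S := DPA tracker_init tracker_step tracker_prio.

Section Run.
Variable w : word S.
Let st n : tracker := run tracker_dpa w n.
Let u n : seq S := (st n).1.1.1.
Let x n : m.-tuple S := (st n).1.1.2.
Let g n := (st n).1.2.
Let T n := (st n).2.
Let F := recurrent x.

Lemma run_tracker n : st n.+1 = (rep (rcons (u n) (w n)), shift (x n) (w n),
  record_seen (g n) (shift (x n) (w n)),
  shift (x n) (w n) |: g n (shift (x n) (w n))).
Proof.
by rewrite /u /x /g /st /=; case: (run tracker_dpa w n) => [[[? ?] ?] ?].
Qed.

Lemma run_prio n : tracker_prio (st n) = 2 * #|T n| + ~~ verdict (u n) (x n) (T n).
Proof. by rewrite /u /x /T; case: (st n) => [[[? ?] ?] ?]. Qed.

(** With [v] arbitrary, the letter just read can be passed from the prefix to the continuation. *)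
Lemma run_rep n v : bisim K (catw (u n) v) 0 (catw (mkseq w n) v) 0.
Proof.
elim: n v => [|n IH] v; first exact: rep_bisim.
rewrite /u run_tracker mkseqS /=; apply: bisim_trans (rep_bisim _ _) _.
by rewrite -!cats1 !catw_cat; exact: IH.
Qed.

Lemma run_factor n : x n = fac (catw (nseq m x0) w) n.
Proof.
elim: n => [|n IH].
  apply: eq_from_tnth => d; rewrite (_ : x 0 = nseq_tuple m x0) // tnth_nseq.
  rewrite tnth_mktuple add0n.
  by rewrite (catw_lt x0) ?size_nseq // nth_nseq ltn_ord.
rewrite {1}/x run_tracker [_.1.1.2]/= IH; apply: eq_from_tnth => d.
rewrite (tnth_nth x0) tnth_mktuple nth_behead nth_rcons size_tuple.
case: ltnP => ltd.
  by rewrite -(tnth_nth x0 _ (Ordinal ltd)) tnth_mktuple addSnnS.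
have -> : d.+1 = m by apply/eqP; rewrite eqn_leq ltd ltn_ord.
rewrite eqxx catw_ge ?size_nseq; have := ltn_ord d; last by lia.
by move=> ?; congr w; lia.
Qed.

Lemma run_factor_late i : x (i + m) = fac w i.
Proof.
rewrite run_factor; apply: factor_ext => d ltd.
by rewrite catw_ge ?size_nseq; [congr w|]; lia.
Qed.

Lemma run_seen n : g n.+1 = record_seen (g n) (x n.+1).
Proof. by rewrite /g /x run_tracker. Qed.

Lemma run_hit n : T n.+1 = hit x g n.
Proof. by rewrite /T /hit /x run_tracker. Qed.

Lemma catw_mkseq n : catw (mkseq w n) (fun i => w (n + i)) = w.
Proof.
apply/funext => i; have [lt|ge] := ltnP i n.
  by rewrite (catw_lt x0) ?size_mkseq // nth_mkseq.
by rewrite catw_ge size_mkseq // subnKC.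
Qed.

Lemma factor_catw_run n v i : m <= n ->
  fac (catw (x n) v) i = fac (catw (mkseq w n) v) (i + (n - m)).
Proof.
move=> lemn; apply: factor_ext => d _.
have [lt|ge] := ltnP (i + d) m.
  rewrite !(catw_lt x0) ?size_mkseq ?size_tuple ?nth_mkseq; try lia.
  rewrite -(tnth_nth x0 _ (Ordinal lt)) run_factor tnth_mktuple.
  by rewrite catw_ge ?size_nseq; [congr w|]; rewrite /=; lia.
rewrite !catw_ge ?size_mkseq ?size_tuple //; last by lia.
by congr v; lia.
Qed.

Lemma run_verdict : exists N, forall n, N <= n -> T n = F ->
  verdict (u n) (x n) (T n) = `[< L w >].
Proof.
have [N0 xF] := eventually_recurrent x.
have Fw i : N0 <= i -> fac w i \in F.
  by move=> lei; rewrite -run_factor_late xF //; lia.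
have infw s : s \in F -> inf_often (fun i => fac w i = s).
  move=> /recurrentP inf n; have [l lel <-] := inf (n + m).
  exists (l - m); first by lia.
  by rewrite -run_factor_late subnK //; lia.
have [n1 Hn1] := tail_bisim Fw infw.
(* This ensures agreement up to [n1], places the factors that straddle the border after [N0], and
   clears the padding [x0] from the window. *)
exists (n1.+1 + N0 + m) => n len TF.
have lemn : m <= n by lia.
have contw v : continuation (x n) F v -> bisim K w 0 (catw (mkseq w n) v) 0.
  have pre i : i < n -> catw (mkseq w n) v i = w i.
    by move=> lti; rewrite (catw_lt x0) ?size_mkseq // nth_mkseq.
  case=> Fv infv; apply: Hn1 => [i lei|i lei|s sF k].
  - by rewrite pre //; lia.
  - have [le|lt] := leqP (i + m) n.
      rewrite (_ : fac _ i = fac w i) ?Fw //.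
      by apply: factor_ext => d ltd; rewrite pre //; lia.
    have := Fv (i - (n - m)).-1; rewrite factor_catw_run //.
    by have -> : (i - (n - m)).-1.+1 + (n - m) = i by lia.
  - have [l lel <-] := infv s sF k.
    by exists (l + (n - m)); [lia | rewrite factor_catw_run].
rewrite TF; apply/asboolP/asboolP => [[v cv Lv]|Lw].
  apply: L_bisim Lv; apply: bisim_trans (run_rep _ _) _.
  exact/bisim_sym/contw.
(* The actual rest of [w] is a continuation. *)
exists (fun i => w (n + i)).
  split=> [i|s sF k]; first by rewrite factor_catw_run // catw_mkseq Fw //; lia.
  have [l lel <-] := infw s sF (k + (n - m)).
  exists (l - (n - m)); first by lia.
  by rewrite factor_catw_run // catw_mkseq subnK //; lia.
by apply: L_bisim Lw; rewrite -{1}(catw_mkseq n); exact/bisim_sym/run_rep.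
Qed.

Lemma tracker_accepts : accepts tracker_dpa w <-> L w.
Proof.
pose p0 := 2 * #|F| + ~~ `[< L w >].
have oddp0 : odd p0 = ~~ `[< L w >].
  by rewrite oddD mul2n odd_double oddb.
have [N1 HN1] := run_verdict.
have [N2 HN2] := hit_sub_recurrent run_seen.
have infp0 : inf_often (fun n => tracker_prio (st n) = p0).
  move=> n; have [l lel hl] := hit_recurrent run_seen (n + N1).
  exists l.+1; first by lia.
  rewrite run_prio HN1 ?run_hit ?hl //; lia.
have maxp0 q : inf_often (fun n => tracker_prio (st n) = q) -> q <= p0.
  move=> /(_ (N1 + N2).+1)[[|n] len] // <-; rewrite run_prio.
  have [eF|neF] := eqVneq (T n.+1) F.
    by rewrite HN1 ?eF //; lia.
  (* For a proper subset of [F], even the odd priority 2|T| + 1 is below 2|F|. *)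
  have : T n.+1 \proper F by rewrite properEneq neF run_hit HN2 //; lia.
  move=> /proper_card ltTF; apply: leq_trans (leq_addr _ _).
  apply: leq_trans (leq_add (leqnn _) (leq_b1 _)) _.
  by rewrite addn1 ltn_pmul2l.
split=> [[p [oddp infp maxp]]|Lw].
  have ep : p = p0 by apply/eqP; rewrite eqn_leq maxp0 // maxp.
  by move: oddp; rewrite ep oddp0 negbK => /asboolP.
by exists p0; split=> //; rewrite oddp0 negbK; apply/asboolP.
Qed.

End Run.

Lemma num_states_tracker :
  num_states tracker_dpa = (\sum_(i < (short_bound S K).+1) #|S| ^ i) *
    #|S| ^ m * (2 ^ (#|S| ^ m)) ^ (#|S| ^ m) * 2 ^ (#|S| ^ m).
Proof.
by rewrite /num_states /= !card_prod card_bseq card_ffun !card_set_type card_tuple.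
Qed.

Lemma num_priorities_tracker :
  num_priorities tracker_dpa <= 2 * #|S| ^ m + 2.
Proof.
rewrite /num_priorities -[leqRHS](size_iota 0).
apply: uniq_leq_size (undup_uniq _) _ => p.
rewrite mem_undup mem_iota add0n => /codomP[[[[u x] g] T] ->] /=.
apply: leq_ltn_trans (leq_add (leqnn _) (leq_b1 _)) _.
by rewrite addn1 addn2 !ltnS leq_pmul2l // -card_tuple max_card.
Qed.

End Automaton.

(** * Size bounds *)

Lemma sum_expn_leq c n : 1 < c -> \sum_(i < n) c ^ i <= c ^ n.
Proof.
move=> c1; elim: n => [|n IH]; first by rewrite big_ord0.
rewrite big_ord_recr expnS; apply: leq_trans (leq_add IH (leqnn _)) _.
by rewrite addnn -mul2n leq_mul2r c1 orbT.
Qed.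

Lemma leq_pow2 n : n <= 2 ^ n.
Proof. exact/ltnW/ltn_expl. Qed.

(** With p predicates, W = (2^p + 1)^(2K + 1) <= 2^(6Kp) and 2W + 3 <= 2^(9Kp); finally 6Kp + 9K^2 p
    <= 15K^2 p. *)
Lemma short_bound_leq (P : finType) K : 0 < K -> 0 < #|P| ->
  short_bound {set P} K <= 2 ^ (15 * (K ^ 2 * #|P|)).
Proof.
move=> K0 p0; rewrite /short_bound.
have leW : num_windows {set P} K <= 2 ^ (6 * (K * #|P|)).
  rewrite /num_windows card_ffun card_option card_ord card_set_type.
  apply: (@leq_trans ((2 ^ (2 * #|P|)) ^ (2 * K).+1)).
    rewrite leq_exp2r // mul2n -addnn expnD.
    by have : 2 ^ 1 <= 2 ^ #|P|; [rewrite leq_exp2l | nia].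
  by rewrite -expnM leq_exp2l //; nia.
have leB : 2 * num_windows {set P} K + 3 <= 2 ^ (9 * (K * #|P|)).
  apply: (@leq_trans (2 ^ (6 * (K * #|P|) + 3))).
    by rewrite expnD; have := expn_gt0 2 (6 * (K * #|P|)); lia.
  by rewrite leq_exp2l //; nia.
rewrite -(leq_exp2r _ _ K0) in leB.
apply: leq_trans (leq_mul leW leB) _.
by rewrite -expnM -expnD leq_exp2l // expnS expn1; nia.
Qed.

(** Let M = K^2 p. The short words number at most 2^(2^(17M)); the other factors have exponents N,
    N^2 and N with N <= 2^(3M). The four exponents sum to at most 4 2^(17M) <= 2^(19M). *)
Lemma tracker_states_leq (P : finType) K : 0 < K -> 0 < #|P| ->
  (\sum_(i < (short_bound {set P} K).+1) #|{set P}| ^ i) *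
    #|{set P}| ^ (2 * K).+1 *
    (2 ^ (#|{set P}| ^ (2 * K).+1)) ^ (#|{set P}| ^ (2 * K).+1) *
    2 ^ (#|{set P}| ^ (2 * K).+1) <= 2 ^ (2 ^ (19 * (K ^ 2 * #|P|))).
Proof.
move=> K0 p0; have leB := short_bound_leq K0 p0.
have cS : #|{set P}| = 2 ^ #|P| := card_set_type P.
have S1 : 1 < #|{set P}| by rewrite cS -[1]/(2 ^ 0) ltn_exp2l.
set M := K ^ 2 * #|P| in leB *.
have leM : K * #|P| <= M by rewrite /M expnS expn1; nia.
have lepM : #|P| <= M by nia.
have leN : #|{set P}| ^ (2 * K).+1 <= 2 ^ (3 * M).
  by rewrite cS -expnM leq_exp2l //; nia.
have leN2 : 2 ^ (3 * M) * 2 ^ (3 * M) <= 2 ^ (17 * M).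
  by rewrite -expnD leq_exp2l //; lia.
have leN1 : 2 ^ (3 * M) <= 2 ^ (17 * M) by rewrite leq_exp2l //; lia.
move: (#|{set P}| ^ (2 * K).+1) leN => N leN.
have leq1 : \sum_(i < (short_bound {set P} K).+1) #|{set P}| ^ i
    <= 2 ^ (2 ^ (17 * M)).
  apply: leq_trans (sum_expn_leq _ S1) _; rewrite cS -expnM leq_exp2l //.
  apply: (@leq_trans (2 ^ M * 2 ^ (16 * M))).
    apply: leq_mul; first exact: leq_trans lepM (leq_pow2 _).
    apply: leq_ltn_trans leB _; rewrite ltn_exp2l //; lia.
  by rewrite -expnD leq_exp2l //; lia.
apply: (@leq_trans (2 ^ (2 ^ (17 * M)) * 2 ^ N * 2 ^ (N * N) * 2 ^ N)).
  by rewrite -expnM !leq_mul ?leq_pow2.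
rewrite -!expnD leq_exp2l //.
apply: (@leq_trans (2 ^ (17 * M) * 2 ^ 2)).
  have leNN := leq_trans (leq_mul leN leN) leN2.
  have {}leN := leq_trans leN leN1.
  by move: leN leNN; rewrite -[2 ^ 2]/4; move: (2 ^ (17 * M)) (N * N) => Q NN; lia.
by rewrite -expnD leq_exp2l //; lia.
Qed.

Lemma tracker_priorities_leq (P : finType) K : 0 < K -> 0 < #|P| ->
  2 * #|{set P}| ^ (2 * K).+1 + 2 <= 2 ^ (5 * (K * #|P|)).
Proof.
move=> K0 p0.
rewrite card_set_type.
rewrite -expnM; apply: (@leq_trans (2 ^ (#|P| * (2 * K).+1) * 2 ^ 2)).
  by have := expn_gt0 2 (#|P| * (2 * K).+1); lia.
by rewrite -expnD leq_exp2l //; nia.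
Qed.

Theorem theorem4p13 :
  exists C1 C2 : nat,
    forall (P : finType) (phi : fo2 P) (k : nat),
      ~~ free VY phi ->
      qdepth phi = k ->
      exists A : dpa {set P},
        [/\ num_states A <= 2 ^ (2 ^ (C1 * ((maxn 1 k) ^ 2 * #|P|))),
            num_priorities A <= 2 ^ (C2 * (maxn 1 k * #|P|))
          & forall w : word {set P}, accepts A w <-> fo2_language phi w].
Proof.
exists 19, 5 => P phi k _ qk; set K := maxn 1 k.
have K0 : 0 < K by rewrite /K; lia.
(* Without predicates the bounds allow two states and one priority; there is only one word, so a
   single state decides. *)
have [p0|p0] := posnP #|P|.
  pose b := `[< fo2_language phi (fun=> set0) >].
  pose A := @DPA {set P} unit tt (fun _ _ => tt) (fun=> nat_of_bool (~~ b)).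
  exists A; rewrite p0 !muln0; split.
  - by rewrite /num_states /= card_unit.
  - rewrite /num_priorities; apply: leq_trans (size_undup _) _.
    by rewrite size_codom card_unit.
  move=> w; have -> : w = fun=> set0.
    apply/funext => n; apply/setP => x; rewrite inE.
    by have := card0_eq p0 x; rewrite inE.
  split=> [[p [oddp infp _]]|Lw].
    have [n _ /=] := infp 0; rewrite /b => ep.
    by move: oddp; rewrite -ep oddb negbK => /asboolP.
  have bT : b by apply/asboolP.
  exists 0; split=> // [n|q /(_ 0)[n _ <-]]; first by exists n; rewrite /= ?bT.
  by rewrite /= bT.
pose L := @fo2_language P phi.
have L_bisim w w' : bisim K w 0 w' 0 -> L w -> L w'.
  have leqK : qdepth phi <= K by rewrite qk leq_maxr.
  move=> b; have d0 : same_dir 0 0 0 0 by [].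
  by have [] := @bisim_sat P phi K w w' (fun=> 0) (fun=> 0) leqK (fun=> b) d0.
have /choice[rep rep_bisim] : forall u : seq {set P},
    exists u' : {bseq short_bound {set P} K of {set P}},
    forall v, bisim K (catw u' v) 0 (catw u v) 0.
  by move=> u; have [u' le b] := short_word K u; exists (Bseq le).
exists (tracker_dpa set0 L rep); split.
- by rewrite num_states_tracker; exact: tracker_states_leq.
- by apply: leq_trans (num_priorities_tracker _ _ _) (tracker_priorities_leq _ _).
- by move=> w; exact: tracker_accepts.
Qed.
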